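(* For each $p\in(1,+\infty]$ there exists a function $f\in\ell^p(\mathbb{Z})$ such that, with $r_n$ denoting the centered discrete frequency function of $f$, the set $$\left\{n\in\mathbb{Z}: \frac{r_n}{|n|}\in\left[\frac18,\frac78\right]\right\}$$ is unbounded.
   Context: $\mathbb{N}$ denotes the non-negative integers. For $f\in\ell^p(\mathbb{Z})$, $n\in\mathbb{Z}$, $r\in\mathbb{N}$, put $A_r|f|(n)=\frac{1}{2r+1}\sum_{j=-r}^{r}|f(n+j)|$ and $Mf(n)=\sup_{r\in\mathbb{N}}A_r|f|(n)$. Let $E_{f,n}=\{r\in\mathbb{N}: Mf(n)=A_r|f|(n)\}$. The frequency function is $r_n=\min E_{f,n}$. For $1<p<\infty$ the set $E_{f,n}$ is always non-empty; for $p=\infty$ it may be empty at some $n$, in which case $r_n=+\infty$ (so such $n$ do not belong to the set in the theorem). The ratio $r_n/|n|$ is considered only for $n\neq0$. *)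

(* Defs.v *)
From HB Require Import structures.
From mathcomp Require Import all_boot all_order all_algebra.
From mathcomp Require Import all_classical all_reals all_analysis.
Set Implicit Arguments.
Unset Strict Implicit.
Unset Printing Implicit Defensive.
Import Order.TTheory GRing.Theory Num.Theory.
Import numFieldNormedType.Exports.
Local Open Scope classical_set_scope.
Local Open Scope ring_scope.

(* The discrete sigma-algebra on int: every function on int is measurable. *)
HB.instance Definition _ := isPointed.Build int 0.
HB.instance Definition _ := @isMeasurable.Build default_measure_display
  int (@discrete_measurable int) (@discrete_measurable0 int)
  (@discrete_measurableC int) (@discrete_measurableU int).

(* \ell^p(Z), for 1 <= p <= +oo, is L^p of the counting measure on int. *)
Definition ellp (R : realType) (p : \bar R) : set (int -> R) :=
  [set f | finite_norm (@counting int R) p f].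

(* The window -r <= j <= r is enumerated as j = i - r with 0 <= i < 2r+1. *)
Definition avg (R : realType) (f : int -> R) (r : nat) (n : int) : R :=
  (2 * r + 1)%:R^-1 * \sum_(i < 2 * r + 1) `|f (n + (i%:Z - r%:Z))|.

Definition maximal (R : realType) (f : int -> R) (n : int) : \bar R :=
  ereal_sup (range (fun r : nat => (avg f r n)%:E)).

Definition radii (R : realType) (f : int -> R) (n : int) : set nat :=
  [set r | maximal f n = (avg f r n)%:E].

Definition frequency (R : realType) (f : int -> R) (n : int) : \bar R :=
  if pselect (exists r, `[< radii f n r >]) is left nonempty
  then (ex_minn nonempty)%:R%:E else +oo%E.

(* Main.v *)
Require Import Defs.
From mathcomp Require Import all_boot all_order all_algebra.
From mathcomp Require Import all_classical all_reals all_analysis.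
From mathcomp Require Import measurable_realfun ess_sup_inf zify ring lra.
Import Order.TTheory GRing.Theory Num.Theory.
Import numFieldNormedType.Exports.
Local Open Scope classical_set_scope.
Local Open Scope ring_scope.

(** Fix a large integer [B] and let [f] be [(4 / B) ^ j] on the block
    [[16 B^j, 17 B^j[] and zero elsewhere. The [j]-th block has mass [4 ^ j], so
    all the blocks before the [k]-th one together weigh less than a third of it.
    Seen from [n = 32 B^k], a radius below [4 B^k] catches nothing, the radius
    [16 B^k] catches exactly the [k]-th block, and a radius above [28 B^k] dilutes
    that block too much while the later, heavier blocks are too far away. Hence
    [n / 8 <= r_n <= 7 n / 8]. The [p]-th powers sum to a geometric series of ratio
    [(4 / B) ^ p * B], which is less than 1 for [B] large since [p > 1]. *)

(** Strictness forces [r0] into the range, so the largest of the finitely many averages with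
    [r <= hi] is the supremum. By strictness again, no radius outside the range attains it. *)
Lemma frequency_between (R : realType) (f : int -> R) (n : int)
    (r0 lo hi : nat) :
  (forall r, ~~ (lo <= r <= hi)%N -> avg f r n < avg f r0 n) ->
  exists2 r, (lo <= r <= hi)%N & frequency f n = r%:R%:E.
Proof.
move=> out.
have r0_hi : (r0 < hi.+1)%N.
  have : (lo <= r0 <= hi)%N by apply: contraT => /out; rewrite ltxx.
  by case/andP.
have [i _ imax] := @arg_maxP _ _ _ (Ordinal r0_hi) xpredT
  (fun i : 'I_hi.+1 => avg f i n) isT.
have avg_le r : avg f r n <= avg f i n.
  have [rhi|rhi] := ltnP r hi.+1; first exact: (imax (Ordinal rhi)).
  apply: le_trans (imax (Ordinal r0_hi) isT).
  by apply/ltW/out; lia.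
have maxE : maximal f n = (avg f i n)%:E.
  apply/le_anti/andP; split.
    by apply: ge_ereal_sup => _ [r _ <-]; rewrite lee_fin.
  by apply: ereal_sup_ubound; exists (i : nat).
rewrite /frequency; case: pselect => [ex|[]]; last first.
  by exists i; apply/asboolP.
case: ex_minnP => r /asboolP rE _; exists r => //.
apply: contraT => /out; rewrite ltNge => /negP[].
by move: maxE; rewrite (rE : maximal f n = _) => -[->].
Qed.

(** * The block function and its partial sums *)

(** When [17 < B], the logarithm is the only index whose block can contain [x], because
    [17 * B ^ j < B ^ j.+1]. *)
Definition bump (R : realType) (B x : nat) : R :=
  let j := trunc_log B x in
  if (16 * B ^ j <= x < 17 * B ^ j)%N then (4 / B%:R) ^+ j else 0.

Definition bumps (R : realType) (B : nat) (n : int) : R :=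
  if n is Posz x then bump R B x else 0.

Lemma bump_ge0 (R : realType) (B x : nat) : 0 <= bump R B x.
Proof. by rewrite /bump; case: ifP => // _; rewrite exprn_ge0 ?divr_ge0. Qed.

Lemma bump_in (R : realType) (B j x : nat) : (17 < B)%N ->
  (16 * B ^ j <= x < 17 * B ^ j)%N -> bump R B x = (4 / B%:R) ^+ j.
Proof.
move=> B17 xj; rewrite /bump (@trunc_log_eq B j x) ?xj//; first lia.
by move: xj; rewrite expnS; nia.
Qed.

Lemma bump_out (R : realType) (B j x : nat) : (17 < B)%N ->
  (17 * B ^ j <= x < 16 * B ^ j.+1)%N -> bump R B x = 0.
Proof.
move=> B17 xj; rewrite /bump; case: ifP => // xl; exfalso.
have B_gt0 : (0 < B)%N by lia.
have [lj|jl] := leqP (trunc_log B x) j.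
  by have := leq_pexp2l B_gt0 lj; lia.
by have := leq_pexp2l B_gt0 jl; lia.
Qed.

Lemma bump_low (R : realType) (B x : nat) : (17 < B)%N ->
  (x < 16)%N -> bump R B x = 0.
Proof.
move=> B17 x16; rewrite /bump; case: ifP => // xl.
have : (0 < B ^ trunc_log B x)%N by rewrite expn_gt0; lia.
by lia.
Qed.

Lemma sum_bump_block (R : realType) (B j : nat) : (17 < B)%N ->
  \sum_(16 * B ^ j <= x < 17 * B ^ j) bump R B x = 4 ^+ j.
Proof.
move=> B17.
rewrite (eq_big_nat _ _ (F2 := fun=> (4 / B%:R) ^+ j)); last first.
  by move=> x xj; exact: bump_in.
rewrite sumr_const_nat -mulnBl mul1n -[LHS]mulr_natr natrX -exprMn divfK//.
by rewrite pnatr_eq0; lia.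
Qed.

Lemma sum_bump_gap (R : realType) (B j y : nat) : (17 < B)%N ->
  (y <= 16 * B ^ j.+1)%N -> \sum_(17 * B ^ j <= x < y) bump R B x = 0.
Proof.
move=> B17 yj; rewrite big_nat big1// => x xj.
by apply: (@bump_out R B j) => //; lia.
Qed.

(** The masses [4 ^ i] with [i < j] add up to [(4 ^ j - 1) / 3]; this form avoids division and suits
    the induction. *)
Lemma sum_bump (R : realType) (B j : nat) : (17 < B)%N ->
  3 * \sum_(0 <= x < 16 * B ^ j) bump R B x + 1 = 4 ^+ j.
Proof.
move=> B17; elim: j => [|j IH].
  by rewrite muln1 big_nat big1 ?mulr0 ?add0r// => x x16; exact: bump_low.
have Bj : (17 * B ^ j <= 16 * B ^ j.+1)%N.
  by rewrite expnS; nia.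
have le1617 : (16 * B ^ j <= 17 * B ^ j)%N by rewrite leq_mul2r orbT.
rewrite (big_cat_nat (leq0n _) (leq_trans le1617 Bj)) (big_cat_nat le1617 Bj).
rewrite sum_bump_block// sum_bump_gap// exprS -IH /=; ring.
Qed.

(** Nonnegativity lets the sum be extended to [[0, 16 * B ^ j[], so only the right end of a window
    matters. *)
Lemma sum_bump_le (R : realType) (B j m y : nat) : (17 < B)%N ->
  (y <= 16 * B ^ j)%N -> 3 * \sum_(m <= x < y) bump R B x <= 4 ^+ j.
Proof.
move=> B17 yj; rewrite -(@sum_bump R B j B17).
have [ym|my] := leqP y m.
  rewrite big_geq// mulr0 addr_ge0// mulr_ge0// sumr_ge0// => x _.
  exact: bump_ge0.
rewrite [X in _ <= 3 * X + 1](big_cat_nat (leq0n m) (ltnW (leq_trans my yj))).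
rewrite (big_cat_nat (ltnW my) yj) /=.
have ge0 a b : 0 <= \sum_(a <= x < b) bump R B x.
  by apply: sumr_ge0 => x _; exact: bump_ge0.
by have := ge0 0 m; have := ge0 y (16 * B ^ j)%N; lra.
Qed.

(** * Averages seen from the points [32 * B ^ k] *)

(** Truncated subtraction clips the window at 0, which loses nothing since [bumps] vanishes on
    negative integers. *)
Lemma avg_bumps (R : realType) (B r m : nat) :
  avg (bumps R B) r m =
  (2 * r + 1)%:R^-1 * \sum_(m - r <= x < m + r + 1) bump R B x.
Proof.
congr (_ * _).
have F i : `|bumps R B (m%:Z + (i%:Z - r%:Z))| =
    if (r <= m + i)%N then bump R B (m + i - r) else 0.
  case: leqP => mi.
    rewrite (_ : m%:Z + (i%:Z - r%:Z) = (m + i - r)%N); last by lia.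
    by rewrite /= ger0_norm// bump_ge0.
  have : m%:Z + (i%:Z - r%:Z) < 0 by lia.
  by case: (_ + _) => //= ? _; rewrite normr0.
rewrite -(big_mkord xpredT (fun i => `|bumps R B (m%:Z + (i%:Z - r%:Z))|)).
under eq_bigr do rewrite F.
(* The first [r - m] indices are the negative positions. *)
rewrite (@big_cat_nat _ _ _ (r - m)) ?leq0n//=; last by lia.
rewrite big_nat big1 ?add0r; last by move=> i ?; rewrite ifN//; lia.
have [rm|mr] := leqP r m.
  rewrite (_ : r - m = 0)%N; last by lia.
  rewrite -[in RHS](add0n (m - r)%N) big_addn.
  rewrite (_ : m + r + 1 - (m - r) = 2 * r + 1)%N; last by lia.
  apply: eq_bigr => i _; rewrite ifT; last by lia.
  by congr bump; lia.
rewrite (_ : m - r = 0)%N; last by lia.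
rewrite -[in LHS](add0n (r - m)%N) big_addn.
rewrite (_ : 2 * r + 1 - (r - m) = m + r + 1)%N; last by lia.
apply: eq_bigr => i _; rewrite ifT; last by lia.
by congr bump; lia.
Qed.

(** The window [[16 * B ^ k, 48 * B ^ k]] has [32 * B ^ k + 1] points and contains the whole [k]-th
    block. *)
Lemma avg_bumps_peak (R : realType) (B k : nat) : (17 < B)%N ->
  (32 * B ^ k + 1)%:R^-1 * 4 ^+ k
    <= avg (bumps R B) (16 * B ^ k)%N (32 * B ^ k)%N.
Proof.
move=> B17; rewrite avg_bumps mulnA ler_wpM2l// ?invr_ge0//.
rewrite (_ : 32 * _ - 16 * _ = 16 * B ^ k)%N; last by lia.
rewrite -(@sum_bump_block R B k B17).
rewrite (@big_cat_nat _ _ _ (17 * B ^ k) _ (32 * B ^ k + _ + _))//=; try lia.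
rewrite lerDl sumr_ge0// => x _; exact: bump_ge0.
Qed.

(** The window stays between [28 * B ^ k] and [36 * B ^ k], inside the gap after the [k]-th
    block. *)
Lemma avg_bumps_small_radius (R : realType) (B k r : nat) : (17 < B)%N ->
  (r < 4 * B ^ k)%N -> avg (bumps R B) r (32 * B ^ k)%N = 0.
Proof.
move=> B17 r4; rewrite avg_bumps big_nat big1 ?mulr0// => x xr.
by apply: (@bump_out R B k); rewrite ?expnS//; nia.
Qed.

(** If no block beyond the [(k + i)]-th is met, the mass is at most [4 ^ (k + i + 1) / 3], so it
    suffices that [4 ^ i.+1 * (32 * B ^ k + 1) < 3 * (2 * r + 1)]. *)
Lemma avg_bumps_large_radius (R : realType) (B k r : nat) : (17 < B)%N ->
  (28 * B ^ k < r)%N ->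
  avg (bumps R B) r (32 * B ^ k)%N < (32 * B ^ k + 1)%:R^-1 * 4 ^+ k.
Proof.
move=> B17 r28.
have Bk : (0 < B ^ k)%N by rewrite expn_gt0; lia.
(* The [k + i]-th block is the last one that the window can meet. *)
have [i yi bound] : exists2 i, (32 * B ^ k + r + 1 <= 16 * B ^ (k + i).+1)%N &
    (4 ^ i.+1 * (32 * B ^ k + 1) < 3 * (2 * r + 1))%N.
  (* Before block [k + 1], take [i = 0]: [3 * (2 * r + 1)] exceeds [168 * B ^ k], hence
     [128 * B ^ k + 4]. *)
  have [near|far] := ltnP (32 * B ^ k + r) (16 * B ^ k.+1).
    by exists 0%N; rewrite ?addn0 ?expn1; lia.
  (* Otherwise the last block met has the largest index [j] with [16 * B ^ j <= y]. *)
  set y := (32 * B ^ k + r)%N in far *.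
  have y16 : (0 < y %/ 16)%N by rewrite divn_gt0//; lia.
  have B1 : (1 < B)%N by lia.
  have := trunc_logP B1 y16; have := trunc_log_ltn (y %/ 16) B1.
  have : (k < trunc_log B (y %/ 16))%N.
    by apply: trunc_log_max => //; rewrite leq_divRL//; lia.
  move: (trunc_log _ _) => j kj; rewrite ltn_divLR// leq_divRL// => ub lb.
  have jE : j = (k + (j - k))%N by lia.
  have i1 : (0 < j - k)%N by lia.
  move: (j - k)%N i1 jE => i i1 jE; subst j; exists i; first lia.
  (* As [16 <= B] and [0 < i], the radius, at least [16 * B ^ (k + i) - 32 * B ^ k], outgrows the
     mass. *)
  have : (4 * 4 ^ i <= B ^ i)%N.
    case: i i1 {kj ub lb} => // i _; rewrite !expnS.
    have : (4 ^ i <= B ^ i)%N.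
      by case: i => [|i] //; rewrite leq_exp2r//; lia.
    by move: (4 ^ i)%N (B ^ i)%N => u v; nia.
  have : (4 <= 4 ^ i)%N.
    by case: i i1 {kj ub lb} => // i _; rewrite expnS leq_pmulr// expn_gt0.
  rewrite expnS; move: lb; rewrite expnD /y.
  move: (4 ^ i)%N (B ^ i)%N (B ^ k)%N Bk => u v w w0 lb u4 uv.
  have : (4 * u * w <= v * w)%N by rewrite leq_mul2r uv orbT.
  have : (4 * w <= u * w)%N by rewrite leq_mul2r u4 orbT.
  by move: (u * w)%N (v * w)%N => a b; nia.
rewrite avg_bumps !addn1 mulrC [ltRHS]mulrC ltr_pdivrMr// mulrAC ltr_pdivlMr//.
have := @sum_bump_le R B (k + i).+1 (32 * B ^ k - r)%N _ B17 yi.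
rewrite addn1 -[X in 4 ^+ X]addnS exprD; set S := \sum_(_ <= x < _) _ => Sle.
rewrite -(ltr_pM2l (ltr0n R 3)) mulrA.
apply: (@le_lt_trans _ _ (4 ^+ k * 4 ^+ i.+1 * (32 * B ^ k).+1%:R)).
  by rewrite ler_wpM2r.
rewrite [ltRHS]mulrCA -mulrA ltr_pM2l ?exprn_gt0//.
by move: bound; rewrite -(ltr_nat R) !natrM natrX !addn1.
Qed.

(** * Membership in the sequence spaces *)

Definition block (B j : nat) : set int :=
  [set n | (16 * B ^ j)%N%:Z <= n < (17 * B ^ j)%N%:Z].

Lemma counting_block_le (R : realType) (B j : nat) :
  (counting (block B j) <= (B ^ j)%:R%:E :> \bar R)%E.
Proof.
set A := block B j.
have AB : (A #<= `I_(B ^ j))%card.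
  have sub : A `<=` (fun i : nat => (16 * B ^ j + i)%N%:Z) @` `I_(B ^ j).
    move=> n; rewrite /A /block /= => nj.
    by exists (`|n| - 16 * B ^ j)%N => /=; lia.
  exact: card_le_trans (subset_card_le sub) (card_image_le _ _).
rewrite /counting asboolT; last exact: card_le_finite AB (finite_II _).
by rewrite lee_fin ler_nat geq_card_fset_set.
Qed.

(** A majorant made of nonnegative weighted indicators can be integrated term by term; the term of
    the block containing [n] already dominates. *)
Lemma bumps_powR_le (R : realType) (B : nat) (p : R) (n : int) :
  (17 < B)%N -> 0 < p ->
  (((`|bumps R B n| `^ p)%R)%:E <= \sum_(0 <= j <oo)
    (((4 / B%:R) `^ p) ^+ j)%:E * (\1_(block B j) n)%:E)%E.
Proof.
move=> B17 p0.
have ge0 j : (0 <= (((4 / B%:R) `^ p) ^+ j)%:E * (\1_(block B j) n : R)%:E)%E.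
  by rewrite mule_ge0// lee_fin// exprn_ge0// powR_ge0.
case: n ge0 => [x|x] ge0; last first.
  by rewrite normr0 powR0 ?gt_eqF// nneseries_ge0.
rewrite /= /bump; case: ifP => [xj|_]; last first.
  by rewrite normr0 powR0 ?gt_eqF// nneseries_ge0.
set j := trunc_log B x in xj *.
apply: le_trans (nneseries_lim_ge j.+1 (fun i _ _ => ge0 i)).
rewrite big_nat_recr//= -[leLHS]add0e leeD ?sume_ge0//.
rewrite indicE mem_set; last by rewrite /block /=; lia.
rewrite mule1 lee_fin ger0_norm ?exprn_ge0 ?divr_ge0//.
by rewrite -powR_mulrn ?divr_ge0// powRAC powR_mulrn ?powR_ge0.
Qed.

Lemma bumps_Lp (R : realType) (B : nat) (p : R) :
  (17 < B)%N -> 0 < p -> (4 / B%:R) `^ p * B%:R < 1 ->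
  ellp p%:E (bumps R B).
Proof.
move=> B17 p0 ratio.
rewrite /ellp /= /finite_norm unlock; apply: poweR_lty.
set c := (4 / B%:R) `^ p in ratio.
have c0 : 0 <= c by exact: powR_ge0.
apply: (@le_lt_trans _ _ (\int[counting]_n \sum_(0 <= j <oo)
    (c ^+ j)%:E * (\1_(block B j) n)%:E)%E).
  apply: ge0_le_integral => //= n _; exact: bumps_powR_le.
rewrite integral_nneseries//; last first.
  by move=> j n _; rewrite mule_ge0// lee_fin// exprn_ge0.
apply: (@le_lt_trans _ _ (\sum_(0 <= j <oo) ((c * B%:R) ^+ j)%:E)%E).
  apply: lee_nneseries => [j _ _|j _].
    by apply: integral_ge0 => n _; rewrite mule_ge0// lee_fin// exprn_ge0.
  rewrite ge0_integralZl//; last by rewrite lee_fin exprn_ge0.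
  rewrite integral_indic// setIT exprMn EFinM lee_wpmul2l ?lee_fin ?exprn_ge0//.
  by rewrite -natrX; exact: counting_block_le.
rewrite (_ : (fun n => _) = EFin \o series (geometric 1 (c * B%:R))).
  rewrite EFin_lim ?ltry//; apply: is_cvg_geometric_series.
  by rewrite ger0_norm// mulr_ge0.
apply/funext => n /=; rewrite /series /= -sumEFin.
by apply: eq_bigr => j _; rewrite mul1r.
Qed.

Lemma bumps_Linfty (R : realType) (B : nat) : (17 < B)%N ->
  ellp +oo%E (bumps R B).
Proof.
move=> B17; rewrite /ellp /= /finite_norm unlock; case: ifPn => // _.
apply: (@le_lt_trans _ _ 1%E); last exact: ltry.
apply/ess_supP; apply: nearW => n /=; rewrite lee_fin.
case: n => [x|x] /=; last by rewrite normr0.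
rewrite /bump; case: ifP => _; last by rewrite normr0.
rewrite ger0_norm ?exprn_ge0 ?divr_ge0// exprn_ile1 ?divr_ge0//.
by rewrite ler_pdivrMr ?mul1r ?ler_nat ?ltr0n; lia.
Qed.

(** The condition amounts to [4 ^ p < B ^ (p - 1)], that is, to [B] exceeding the threshold [z]; the
    summand 18 secures [17 < B]. *)
Lemma exists_ratio_lt1 (R : realType) (p : R) : 1 < p ->
  exists2 B : nat, (17 < B)%N & (4 / B%:R) `^ p * B%:R < 1.
Proof.
move=> p1; set z := 4 `^ (p / (p - 1)).
pose B := (Num.truncn z + 18)%N.
have zB : z < B%:R.
  by apply: lt_le_trans (truncnS_gt z) _; rewrite ler_nat -addn1 leq_add2l.
exists B; first by rewrite /B; lia.
have B0 : 0 < B%:R :> R by rewrite ltr0n /B; lia.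
have p0 : 0 < p by lra.
have B4 : 4 `^ p < B%:R `^ (p - 1).
  have -> : 4 `^ p = z `^ (p - 1) by rewrite -powRrM divfK//; lra.
  by apply: gt0_ltr_powR; rewrite ?nnegrE ?powR_ge0// ?ler0n// subr_gt0.
have powRV : (B%:R^-1 : R) `^ p = (B%:R `^ p)^-1.
  by rewrite -(powR_inv1 (ler0n R B)) -powRrM mulN1r powRN.
rewrite powRM ?invr_ge0// powRV.
rewrite -(mulr_powRB1 (ler0n R B))// mulrAC ltr_pdivrMr ?mulr_gt0 ?powR_gt0//.
by rewrite mul1r mulrC ltr_pM2l.
Qed.

(** * The frequency function at the chosen points *)

(** The value [4 ^ k / (32 * B ^ k + 1)] separates the radius [16 * B ^ k] from all radii outside
    the range. *)
Lemma frequency_bumps (R : realType) (B k : nat) : (17 < B)%N ->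
  exists2 r, (4 * B ^ k <= r <= 28 * B ^ k)%N &
    frequency (bumps R B) (32 * B ^ k)%N = r%:R%:E.
Proof.
move=> B17; apply: (@frequency_between _ _ _ (16 * B ^ k)%N) => r r_out.
apply: lt_le_trans (avg_bumps_peak R B k B17).
have [r4|r4] := ltnP r (4 * B ^ k).
  by rewrite avg_bumps_small_radius// mulr_gt0// exprn_gt0.
by apply: avg_bumps_large_radius => //; lia.
Qed.

Theorem theorem2p9 (R : realType) (p : \bar R) (hp : (1 < p)%E) :
  exists2 f : int -> R, ellp p f &
    ~ bounded_set [set (n%:~R : R) | n in
        [set n : int | n != 0 /\
          (frequency f n / (`|n|%:~R)%:E)%E \in `[(1 / 8)%:E, (7 / 8)%:E]]].
Proof.
have [B B17 fp] : exists2 B : nat, (17 < B)%N & ellp p (bumps R B).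
  case: p hp => [p| |] hp //.
    rewrite lte_fin in hp; have [B B17 ratio] := exists_ratio_lt1 R p hp.
    by exists B => //; apply: bumps_Lp => //; lra.
  (* At [p = +oo] bounded heights suffice, so the least admissible [B] serves. *)
  by exists 18%N => //; exact: bumps_Linfty.
exists (bumps R B) => // -[M [Mreal bounded]].
have := bounded (M + 1) (ltr_pwDr ltr01 (lexx M)).
(* Since [k < B ^ k], the point [32 * B ^ k] is at least [k + 1], which exceeds [M + 1]. *)
set k := Num.truncn (M + 1) => /(_ (32 * B ^ k)%N%:~R) /=.
have Bk : (0 < B ^ k)%N by rewrite expn_gt0; lia.
apply/not_implyP; split; last first.
  apply/negP; rewrite -ltNge ger0_norm//.
  apply: lt_le_trans (truncnS_gt (M + 1)) _; rewrite -/k -pmulrn ler_nat.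
  have : (k < B ^ k)%N by apply: ltn_expl; lia.
  by lia.
exists (32 * B ^ k)%N => //; split; first by lia.
have [r rE ->] := frequency_bumps R B k B17.
have N0 : 0 < (B ^ k)%:R :> R by rewrite ltr0n.
rewrite ger0_norm// inver ifN; last by rewrite -pmulrn pnatr_eq0; lia.
have [r4 r28] : 4 * (B ^ k)%:R <= r%:R :> R /\ r%:R <= 28 * (B ^ k)%:R :> R.
  by rewrite -!natrM !ler_nat; apply/andP.
rewrite -EFinM in_itv /= !lee_fin -pmulrn natrM.
rewrite ler_pdivlMr ?ler_pdivrMr ?mulr_gt0//.
by apply/andP; split; lra.
Qed.
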